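(* Let $G$ be a finite subgroup of $\mathrm{SO}(4)$. Then every irreducible complex representation of $G$ has dimension at most $36$.
   Context: $\mathrm{SO}(4)$ denotes the real special orthogonal group of $4\times 4$ matrices. Representations are finite-dimensional over $\mathbb{C}$. *)

(* Defs.v *)
From HB Require Import structures.
From mathcomp Require Import all_boot all_order all_algebra all_fingroup.
From mathcomp Require Import mxrepresentation finmap.
From mathcomp Require Import reals.
From mathcomp Require Import complex.

Set Implicit Arguments.
Unset Strict Implicit.
Unset Printing Implicit Defensive.

Import GRing.Theory.
Local Open Scope ring_scope.

Definition is_SO (R : realType) (n : nat) : pred 'M[R]_n :=
  fun A => (A *m A^T == 1%:M) && (\det A == 1).

Record SO (R : realType) (n : nat) : Type :=
  MkSO { SOval :> 'M[R]_n; SOvalP : is_SO SOval }.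

HB.instance Definition _ (R : realType) (n : nat) :=
  [isSub for @SOval R n].
HB.instance Definition _ (R : realType) (n : nat) :=
  [Choice of SO R n by <:].

Section SOGroup.
Variables (R : realType) (n : nat).
Implicit Types A B C : SO R n.

Lemma SO_orthogonal A : A *m A^T = 1%:M.
Proof. by have /andP[/eqP] := SOvalP A. Qed.

Lemma SO_det A : \det A = 1.
Proof. by have /andP[_ /eqP] := SOvalP A. Qed.

Lemma SO_mul_subproof A B : is_SO (A *m B).
Proof.
rewrite /is_SO trmx_mul mulmxA -[A *m B *m _]mulmxA SO_orthogonal mulmx1.
by rewrite SO_orthogonal det_mulmx !SO_det mulr1 !eqxx.
Qed.

Lemma SO_one_subproof : is_SO (1%:M : 'M[R]_n).
Proof. by rewrite /is_SO trmx1 mulmx1 det1 !eqxx. Qed.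

Lemma SO_inv_subproof A : is_SO A^T.
Proof.
by rewrite /is_SO trmxK (mulmx1C (SO_orthogonal A)) det_tr SO_det !eqxx.
Qed.

Definition SO_mul A B := MkSO (SO_mul_subproof A B).
Definition SO_one := MkSO SO_one_subproof.
Definition SO_inv A := MkSO (SO_inv_subproof A).

Lemma SO_mulA : associative SO_mul.
Proof. by move=> A B C; apply/val_inj; rewrite /= mulmxA. Qed.
Lemma SO_mul1 : left_id SO_one SO_mul.
Proof. by move=> A; apply/val_inj; rewrite /= mul1mx. Qed.
Lemma SO_mulr1 : right_id SO_one SO_mul.
Proof. by move=> A; apply/val_inj; rewrite /= mulmx1. Qed.
Lemma SO_mulV : left_inverse SO_one SO_inv SO_mul.
Proof. by move=> A; apply/val_inj/mulmx1C/SO_orthogonal. Qed.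
Lemma SO_mulrV : right_inverse SO_one SO_inv SO_mul.
Proof. by move=> A; apply/val_inj/SO_orthogonal. Qed.

HB.instance Definition _ :=
  isGroup.Build (SO R n) SO_mulA SO_mul1 SO_mulr1 SO_mulV SO_mulrV.
End SOGroup.

Record finSubgroup (gT : groupType) : Type := FinSubgroup {
  fsg_set : {fset gT};
  fsg_closed : group_closed (mem fsg_set) }.

(* mx_representation needs a finGroupType, while gT may be infinite: the elements
   of H are packaged as a finGroupType, with the operations of gT, and the group
   H itself is then [set: H]. *)
Definition fsg_elt (gT : groupType) (H : finSubgroup gT) : Type :=
  fset_sub_type (fsg_set H).
Coercion fsg_elt : finSubgroup >-> Sortclass.

Section FinSubgroupGroup.
Variables (gT : groupType) (H : finSubgroup gT).

HB.instance Definition _ := SubFinite.on (fsg_elt H).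
HB.instance Definition _ :=
  SubChoice_isSubGroup.Build gT (mem (fsg_set H)) (fsg_elt H) (fsg_closed H).
End FinSubgroupGroup.

(* Main.v *)
Require Import Defs.
From HB Require Import structures.
From mathcomp Require Import all_boot all_order all_algebra all_fingroup.
From mathcomp Require Import all_solvable all_field ring lra.
From mathcomp Require Import classfun character integral_char.
From mathcomp Require Import mxrepresentation finmap reals complex.

(** Pairs (p, q) of unit quaternions act on the quaternions, a Euclidean space
    of dimension 4, by x |-> p x q^-1. This maps the group of such pairs onto
    SO(4) ([rotation_surj]) and only (1, 1) and (-1, -1) act trivially
    ([rotation_ker]), so a finite G in SO(4) is the image of a finite group H of
    pairs. Irreducible characters of G are irreducible characters of H, and H
    has two quotients, its projections L and L' on the two factors, whose
    kernels meet trivially. The product of the regular characters of L and L' is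
    then a multiple of the regular character of H, so every irreducible
    character of H is a constituent of a product of irreducible characters of L
    and L' ([irr1_le_mul_of_quotients]). Since 36 = 6 * 6, it remains to bound
    by 6 the degrees of a finite group L of unit quaternions.

    Two facts about quaternions suffice for that. A quaternion commutes with a
    non-real x exactly when its vector part is parallel to that of x. Hence
    centralisers of noncentral elements of L are abelian, and a conjugate of x
    that commutes with x is x or x^-1, having the same real part and the same
    norm. The centralisers of noncentral elements therefore meet pairwise in the
    centre Z, and have index at most 2 in their normalisers. Counting the
    elements of L outside Z according to the conjugacy class of their
    centraliser gives, with N = |L : Z|,

        1 - 1 / N = \sum (1 - 1 / a) / c,     a = |C : Z|, c = |N_L(C) : C|,

    where C runs over centralisers up to conjugacy ([class_equation_cent1]).
    As a >= 2 and c is 1 or 2, there are three possibilities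
    ([class_equation_solutions]): L is abelian; or N <= 2 a for some C, which is
    then an abelian subgroup of index at most 2, so that degrees are at most 2;
    or N is 12, 24 or 60, the tetrahedral, octahedral and icosahedral cases. The square of a degree is at most N and a
    degree divides N; hence a degree is at most 7, and it is not 7
    ([irr1_le6_of_abelian_cent1]).

    Character theory is about representations over the algebraic numbers, while
    here the field is F = R[i]. The bridge is [irreducible_degree_le_irr1]: the
    entries of the finitely many irreducible matrix representations are
    rational polynomials in one algebraic number z, and sending z to a root in
    F of its minimal polynomial turns them into representations over F. Their
    characters still add up to the regular character, so they cannot all be
    orthogonal to a given irreducible representation, which is then a quotient
    of one of them. *)

Set Implicit Arguments.
Unset Strict Implicit.
Unset Printing Implicit Defensive.

Import GroupScope Order.TTheory GRing.Theory Num.Theory.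
Local Open Scope ring_scope.

(** * Degrees over an algebraically closed field of characteristic zero *)

(** A number z generating the field of the given numbers is sent to a root in F
    of its minimal polynomial p; a rational polynomial vanishing at z is a
    multiple of p, so it vanishes there too. *)
Lemma algC_specialization (F : numClosedFieldType) (s : seq algC) :
  exists (evC : {rmorphism {poly rat} -> algC}) (evF : {rmorphism {poly rat} -> F}),
    (forall x, x \in s -> exists p, evC p = x) /\
    (forall p, evC p = 0 -> evF p = 0).
Proof.
have [z _ [ps s_ps]] := algC_PET s.
have [p [pz p_monic p_min]] := minCpolyP z.
have pz0 : root (map_poly ratr p) z by rewrite p_min dvdpp.
have [w pw] : exists w : F, root (map_poly ratr p) w.
  apply/closed_rootP; rewrite size_map_poly; apply/eqP => p1.
  have /size_poly1P[c c0 pc]: size p == 1%N by apply/eqP.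
  by move: pz0; rewrite pc map_polyC rootC fmorph_eq0 (negPf c0).
exists (horner_eval z \o map_poly ratr); exists (horner_eval w \o map_poly ratr).
split=> [x|q /= /eqP qz].
  by rewrite s_ps => /mapP[q _ ->]; exists q.
have /dvdpP[r ->]: p %| q by rewrite -p_min; exact: qz.
by rewrite /= /horner_eval rmorphM hornerM (eqP (pw : _ == _)) mulr0.
Qed.

(** Multiplicativity of a representation is a family of polynomial identities
    between its entries, which survive the change of evaluation. *)
Lemma specialize_mx_repr (gT : finGroupType) (G : {group gT}) (K F : fieldType)
  (A : nzRingType) (evK : {rmorphism A -> K}) (evF : {rmorphism A -> F}) n
  (rho : mx_representation K G n) (P : gT -> 'M[A]_n) :
  (forall a, evK a = 0 -> evF a = 0) ->
  {in G, forall g, map_mx evK (P g) = rho g} ->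
  mx_repr G (fun g => map_mx evF (P g)).
Proof.
move=> ker_ev evP.
have ev_eq a b : evK a = evK b -> evF a = evF b.
  move=> /eqP; rewrite -subr_eq0 -rmorphB => /eqP/ker_ev/eqP.
  by rewrite rmorphB subr_eq0 => /eqP.
have ev_mx (B C : 'M[A]_n) : map_mx evK B = map_mx evK C -> map_mx evF B = map_mx evF C.
  by move=> BC; apply/matrixP => i j; have /matrixP/(_ i j) := BC; rewrite !mxE => /ev_eq.
split=> [|g h Gg Gh].
  by rewrite -(map_mx1 evF); apply: ev_mx; rewrite evP // repr_mx1 map_mx1.
rewrite -map_mxM; apply: ev_mx.
by rewrite map_mxM !evP ?groupM // repr_mxM.
Qed.

(** Averaging over G turns an arbitrary matrix into an intertwiner. If all the
    averages of the elementary matrices vanished, so would the sum of products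
    of traces; a nonzero intertwiner into an irreducible module is onto. *)
Lemma irreducible_degree_le_of_trace (gT : finGroupType) (G : {group gT})
  (F : fieldType) m n (rV : mx_representation F G m) (rW : mx_representation F G n) :
  \sum_(g in G) \tr (rW g) * \tr (rV g^-1%g) != 0 ->
  mx_irreducible rV -> (m <= n)%N.
Proof.
move=> tr_neq0 irrV.
pose T (X : 'M_(n, m)) := \sum_(g in G) rW g *m X *m rV g^-1%g.
have [X TX0] : exists ij : 'I_n * 'I_m, T (delta_mx ij.1 ij.2) != 0.
  apply/existsP; apply: contraNT tr_neq0 => /existsPn T0.
  have trE (i : 'I_n) (j : 'I_m) : \sum_(g in G) rW g i i * rV g^-1%g j j = 0.
    have /eqP/matrixP/(_ i j) := negPn (T0 (i, j)).
    rewrite [in RHS]mxE /T summxE => {2}<-; apply: eq_bigr => g _.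
    rewrite /= -(mul_delta_mx (0 : 'I_1)) mulmxA -colE -mulmxA -rowE.
    by rewrite !mxE big_ord1 !mxE.
  under eq_bigr do rewrite /mxtrace big_distrlr /=.
  rewrite exchange_big big1 // => i _; by rewrite exchange_big big1.
set Y := T _ in TX0.
have Yrho h : h \in G -> rW h *m Y = Y *m rV h.
  move=> Gh; rewrite /Y /T mulmx_sumr mulmx_suml.
  rewrite [RHS](reindex_inj (mulgI h)) /=.
  apply: eq_big => [g|g Gg]; first by rewrite groupMl.
  by rewrite invMg -!mulmxA -repr_mxM ?groupM ?groupV // mulgVK mulmxA -repr_mxM // mulmxA.
have /mx_irrP[_ /(_ <<Y>>%MS)] := irrV.
rewrite /row_full mxrank_gen -mxrank_eq0 mxrank_gen mxrank_eq0 => fullY.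
suff /eqP<- : \rank Y == m by exact: rank_leq_row.
apply: fullY => //; apply/mxmoduleP => g Gg.
by rewrite (eqmxMr _ (genmxE Y)) genmxE -Yrho // submxMl.
Qed.

Local Notation irr_deg i := (irr_degree (socle_of_Iirr i)).

(** Weighted by their degrees, the specialised characters add up to the regular
    character, whose pairing with rho is |G| n; so one of them is not orthogonal
    to rho. This does not depend on their irreducibility, whence an inequality
    rather than an equality of degrees. *)
Lemma irreducible_degree_le_irr1 (F : numClosedFieldType) (gT : finGroupType)
  (G : {group gT}) n (rho : mx_representation F G n) : mx_irreducible rho ->
  exists i : Iirr G, n%:R <= 'chi_i 1%g.
Proof.
move=> irr_rho.
pose entries := flatten [seq flatten [seq [seq 'Chi_(i : Iirr G) g ab.1 ab.2
  | ab <- enum {: 'I_(irr_deg i) * 'I_(irr_deg i)}]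
  | g <- enum gT] | i <- enum (Iirr G)].
have [evC [evF [evC_onto ker_ev]]] := algC_specialization F entries.
have [P evP] : exists P : forall i : Iirr G, gT -> 'M[{poly rat}]_(irr_deg i),
    forall i g, map_mx evC (P i g) = 'Chi_i g.
  apply: (fin_all_exists (P := fun i P => forall g, map_mx evC (P g) = 'Chi_i g)) => i.
  apply: (fin_all_exists (P := fun g M => map_mx evC M = 'Chi_i g)) => g.
  have [p evp] : exists p : 'I_(irr_deg i) * 'I_(irr_deg i) -> {poly rat},
      forall ab, evC (p ab) = 'Chi_i g ab.1 ab.2.
    apply: (fin_all_exists (P := fun ab x => evC x = 'Chi_i g ab.1 ab.2)) => ab.
    apply: evC_onto.
    apply/flatten_mapP; exists i; rewrite ?mem_enum //.
    apply/flatten_mapP; exists g; rewrite ?mem_enum //.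
    by apply/mapP; exists ab; rewrite ?mem_enum.
  exists (\matrix_(a, b) p (a, b)); apply/matrixP => a b.
  by rewrite [LHS]mxE [X in evC X]mxE evp.
pose W i := MxRepresentation (specialize_mx_repr ker_ev (in1W (evP i))).
have regW g : g \in G -> \sum_i (irr_deg i)%:R * \tr (W i g) = #|G|%:R *+ (g == 1%g).
  move=> Gg; pose q := \sum_i (irr_deg i)%:R * \tr (P i g).
  have evq : evC q = #|G|%:R *+ (g == 1%g).
    rewrite -cfRegE cfReg_sum sum_cfunE rmorph_sum; apply: eq_bigr => i _.
    rewrite rmorphM rmorph_nat cfunE irr1_degree -irrRepr cfunE Gg mulr1n -evP.
    by rewrite trace_map_mx.
  have : evF (q - #|G|%:R *+ (g == 1%g)) = 0.
    by apply: (ker_ev); rewrite rmorphB evq rmorphMn rmorph_nat subrr.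
  move/eqP; rewrite rmorphB rmorphMn rmorph_nat subr_eq0 => /eqP <-.
  rewrite rmorph_sum; apply: eq_bigr => i _.
  by rewrite rmorphM rmorph_nat /W /= trace_map_mx.
have [i Wi] : exists i, \sum_(g in G) \tr (W i g) * \tr (rho g^-1%g) != 0.
  apply/existsP; apply: contraT => /existsPn orthW.
  have: \sum_i (irr_deg i)%:R * (\sum_(g in G) \tr (W i g) * \tr (rho g^-1%g)) == 0.
    by rewrite big1 // => i _; have := orthW i; rewrite negbK => /eqP->; rewrite mulr0.
  under eq_bigr do rewrite mulr_sumr.
  rewrite exchange_big /= (bigD1 1%g) //= [X in _ + X]big1 ?addr0 => [|g /andP[Gg g1]].
    under eq_bigr do rewrite mulrA.
    rewrite -mulr_suml regW // eqxx mulr1n invg1 repr_mx1 mxtrace1 mulf_eq0.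
    by have /mx_irrP[n_gt0 _] := irr_rho; rewrite !pnatr_eq0 !gtn_eqF ?cardG_gt0 //.
  under eq_bigr do rewrite mulrA.
  by rewrite -mulr_suml regW // (negPf g1) mul0r.
exists i; rewrite irr1_degree ler_nat.
exact: irreducible_degree_le_of_trace Wi irr_rho.
Qed.

(** * Degrees of characters, abelian subgroups and quotients *)

(** By Frobenius reciprocity the character is a constituent of one induced from
    a linear character of A. *)
Lemma irr1_le_index_abelian (gT : finGroupType) (G A : {group gT}) (i : Iirr G) :
  A \subset G -> abelian A -> 'chi_i 1%g <= #|G : A|%g%:R.
Proof.
move=> sAG cAA; have [j Rj] := neq0_has_constt (Res_irr_neq0 A i).
have lin_j : 'chi_j \is a linear_char by apply/char_abelianP.
have := char1_ge_constt (cfInd_char G (irr_char j)).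
by move=> /(_ i); rewrite constt_Ind_Res cfInd1 // (lin_char1 lin_j) mulr1; apply.
Qed.

(** The inflations to G of the regular characters of G / M and G / N are
    supported on M and N, so their product is supported on the identity: it is a
    positive multiple of the regular character, and contains every irreducible
    character. *)
Lemma irr1_le_mul_of_quotients (gT : finGroupType) (G M N : {group gT}) (m n : nat) :
    M <| G -> N <| G -> M :&: N = 1%g ->
    (forall i : Iirr (G / M), 'chi_i 1%g <= m%:R) ->
    (forall i : Iirr (G / N), 'chi_i 1%g <= n%:R) ->
  forall i : Iirr G, 'chi_i 1%g <= (m * n)%:R.
Proof.
move=> nsMG nsNG tiMN degM degN k.
pose reg (H : {group gT}) := (cfReg (G / H) %% H)%CF : 'CF(G).
have regE (H : {group gT}) x : H <| G -> x \in G -> reg H x = #|G / H|%g%:R *+ (x \in H).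
  move=> nsHG Gx; rewrite cfModE // (cfRegE (G / H)%G); congr (_ *+ nat_of_bool _).
  have nHx : x \in 'N(H) by apply: subsetP Gx; apply: normal_norm.
  by apply/eqP/idP => [/coset_idr->|/coset_id].
have regMN : reg M * reg N = (#|G / M|%g%:R * #|G / N|%g%:R) / #|G|%:R *: cfReg G.
  apply/cfun_inP => x Gx; rewrite [LHS]cfunE [RHS]cfunE !regE // cfRegE.
  have -> : (x == 1%g) = (x \in M) && (x \in N) by rewrite -in_setI tiMN inE.
  case: (x \in M); case: (x \in N); rewrite ?mul0r ?mulr0 //= !mulr1n.
  by rewrite divfK // neq0CG.
have regsum (H : {group gT}) :
    reg H = \sum_i 'chi[G / H]_i 1%g *: ('chi_i %% H)%CF.
  by rewrite /reg cfReg_sum linear_sum; apply: eq_bigr => i _; rewrite linearZ.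
have regk : '[reg M * reg N, 'chi_k] != 0.
  rewrite regMN cfdotZl cfReg_sum cfdot_suml (bigD1 k) //= big1 => [|j jk].
    rewrite cfdotZl cfnorm_irr mulr1 addr0 !mulf_neq0 ?invr_eq0 ?neq0CG //.
    exact: irr1_neq0.
  by rewrite cfdotZl cfdot_irr (negPf jk) mulr0.
pose infl (H : {group gT}) (i : Iirr (G / H)) : 'CF(G) := ('chi_i %% H)%CF.
have [[i j] /= Nij] : exists ij, '[infl M ij.1 * infl N ij.2, 'chi_k] != 0.
  apply/existsP; apply: contraNT regk => /existsPn orth_k.
  rewrite !regsum mulr_suml cfdot_suml big1 // => i _.
  rewrite mulr_sumr cfdot_suml big1 // => j _.
  rewrite -scalerAl -scalerAr !cfdotZl.
  by move: (orth_k (i, j)); rewrite negbK => /eqP->; rewrite !mulr0.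
have Cij : infl M i * infl N j \is a character.
  by rewrite rpredM // cfMod_char // irr_char.
have /le_trans := char1_ge_constt Cij Nij; apply.
rewrite cfunE !cfMod1 natrM.
by rewrite ler_pM ?degM ?degN // ltW // irr1_gt0.
Qed.

(** * Numerical solutions of the class equation *)

(** The information on an inverse 1 / a with a >= 2 that solving the class
    equation requires: from a = 6 on, 1/2 + 1/3 + 1/a > 1 fails. *)
Definition unit_fraction_spec (al : rat) : Prop :=
  [\/ al = 1 / 2, al = 1 / 3, al = 1 / 4 | al = 1 / 5 \/ 0 < al <= 1 / 6].

Lemma inv_nat_spec (a : nat) :
  (2 <= a)%N -> unit_fraction_spec a%:R^-1.
Proof.
case: a => [|[|[|[|[|[|a]]]]]] //= _; rewrite /unit_fraction_spec !div1r.
- by constructor 1.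
- by constructor 2.
- by constructor 3.
- by constructor 4; left.
by constructor 4; right; rewrite invr_gt0 ltr0n lef_pV2 ?posrE ?ltr0n // ler_nat.
Qed.

(** The conclusion nu = 1 / 12 occurs for (1 / al, c) = (3, 1) and
    (1 / be, d) = (2, 2), or the other way around: the case of the binary
    tetrahedral group, whose elements of order 3 are not conjugate to their
    inverses. *)
Lemma class_equation_two (al be c d nu : rat) :
    unit_fraction_spec al -> unit_fraction_spec be ->
    c = 1 \/ c = 2 -> d = 1 \/ d = 2 -> 0 < nu ->
    (1 - al) / c + (1 - be) / d = 1 - nu ->
  (al / 2 <= nu \/ be / 2 <= nu) \/ nu = 12%:R^-1.
Proof.
by move=> [->|->|->|[->|/andP[? ?]]] [->|->|->|[->|/andP[? ?]]] [->|->] [->|->] ? ?; lra.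
Qed.

(** Up to order, the inverses of al, be, ga are (2, 2, m) with nu = 1 / 2m, or
    (2, 3, 3), (2, 3, 4), (2, 3, 5). *)
Lemma class_equation_three (al be ga nu : rat) :
    unit_fraction_spec al -> unit_fraction_spec be ->
    unit_fraction_spec ga -> 0 < nu ->
    (1 - al) / 2 + ((1 - be) / 2 + (1 - ga) / 2) = 1 - nu ->
  [\/ al / 2 <= nu, be / 2 <= nu | ga / 2 <= nu] \/
  [\/ nu = 12%:R^-1, nu = 24%:R^-1 | nu = 60%:R^-1].
Proof.
move=> [->|->|->|[->|/andP[? ?]]] [->|->|->|[->|/andP[? ?]]] [->|->|->|[->|/andP[? ?]]] ? E;
  try by [exfalso; lra];
    first [by left; constructor 1; lra | by left; constructor 2; lra |
           by left; constructor 3; lra | by right; constructor 1; lra |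
           by right; constructor 2; lra | by right; constructor 3; lra].
Qed.

(** Every term is at least 1/4 and the sum is less than 1, so there are at most
    three terms. *)
Lemma class_equation_solutions (s : seq (nat * nat)) (N : nat) :
    (0 < N)%N ->
    (forall p, p \in s -> (2 <= p.1)%N /\ (p.2 == 1%N) || (p.2 == 2%N)) ->
    \sum_(p <- s) (1 - p.1%:R^-1) / p.2%:R = 1 - N%:R^-1 :> rat ->
  [\/ N = 1%N, exists2 p, p \in s & (N <= 2 * p.1)%N | N \in [:: 12; 24; 60]%N].
Proof.
move=> N_gt0 s_ok.
pose nu := N%:R^-1 : rat.
have nu_gt0 : 0 < nu by rewrite invr_gt0 ltr0n.
have leN a : (2 <= a)%N -> a%:R^-1 / 2 <= nu -> (N <= 2 * a)%N.
  move=> a2; rewrite /nu -invfM lef_pV2 ?posrE ?mulr_gt0 ?ltr0n ?(ltn_trans _ a2) //.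
  by rewrite -natrM ler_nat mulnC.
have eqN b : nu = b.+1%:R^-1 -> N = b.+1.
  by move=> /invr_inj/eqP; rewrite eqr_nat => /eqP.
rewrite -/nu; move: nu nu_gt0 leN eqN => nu nu_gt0 leN eqN.
have termE p : p \in s ->
   ((p.2 = 1%N) \/ (p.2 = 2%N)) /\ unit_fraction_spec p.1%:R^-1.
  case/s_ok => a2 c12; split; last exact: inv_nat_spec.
  by case/orP: c12 => /eqP->; [left | right].
have terms_ge p : p \in s -> 1 / 4 <= (1 - p.1%:R^-1) / p.2%:R :> rat.
  by case/termE => -[] -> [->|->|->|[->|/andP[? ?]]]; lra.
case: s s_ok termE terms_ge => [|p [|q [|r [|t s]]]] s_ok termE terms_ge.
- by rewrite big_nil => nu1; constructor 1; apply: (eqN 0%N); rewrite invr1; lra.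
- rewrite big_seq1; have [p2 _] := s_ok p (mem_head _ _).
  have [c12 al] := termE p (mem_head _ _) => E.
  constructor 2; exists p; first exact: mem_head.
  apply: leN => //; move: E; case: c12 => ->; case: al => [->|->|->|[->|/andP[? ?]]]; lra.
- have ps : p \in [:: p; q] by rewrite mem_head.
  have qs : q \in [:: p; q] by rewrite !inE eqxx orbT.
  rewrite big_cons big_seq1.
  have [[p2 _] [q2 _]] := (s_ok p ps, s_ok q qs).
  have [[cp alp] [cq alq]] := (termE p ps, termE q qs) => E.
  have [[lep|leq]|nuE] : (p.1%:R^-1 / 2 <= nu \/ q.1%:R^-1 / 2 <= nu) \/ nu = 12%:R^-1.
  + apply: class_equation_two alp alq _ _ nu_gt0 E; [case: cp | case: cq] => ->; tauto.
  + by constructor 2; exists p => //; apply: leN.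
  + by constructor 2; exists q => //; apply: leN.
  by constructor 3; rewrite (eqN 11%N).
- have ps : p \in [:: p; q; r] by rewrite mem_head.
  have qs : q \in [:: p; q; r] by rewrite !inE eqxx orbT.
  have rs : r \in [:: p; q; r] by rewrite !inE eqxx !orbT.
  rewrite 2!big_cons big_seq1.
  have [[p2 _] [q2 _] [r2 _]] := And3 (s_ok p ps) (s_ok q qs) (s_ok r rs).
  have [tp tq tr] := And3 (terms_ge p ps) (terms_ge q qs) (terms_ge r rs).
  have [[cp alp] [cq alq] [cr alr]] := And3 (termE p ps) (termE q qs) (termE r rs) => E.
  have c_eq2 t : t \in [:: p; q; r] -> t.2 = 1%N -> 1 / 2 <= (1 - t.1%:R^-1) / t.2%:R :> rat.
    by case/termE => _ al ->; case: al => [->|->|->|[->|/andP[? ?]]]; lra.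
  have {}cp : p.2 = 2%N by case: cp => // /(c_eq2 p ps) h; exfalso; lra.
  have {}cq : q.2 = 2%N by case: cq => // /(c_eq2 q qs) h; exfalso; lra.
  have {}cr : r.2 = 2%N by case: cr => // /(c_eq2 r rs) h; exfalso; lra.
  move: E; rewrite cp cq cr => E {tp tq tr c_eq2 cp cq cr s_ok termE terms_ge}.
  have [[lep|leq|ler]|nuE] :
    [\/ p.1%:R^-1 / 2 <= nu, q.1%:R^-1 / 2 <= nu | r.1%:R^-1 / 2 <= nu] \/
    [\/ nu = 12%:R^-1, nu = 24%:R^-1 | nu = 60%:R^-1].
  + exact: class_equation_three alp alq alr nu_gt0 E.
  + by constructor 2; exists p => //; apply: leN.
  + by constructor 2; exists q => //; apply: leN.
  + by constructor 2; exists r => //; apply: leN.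
  constructor 3; case: nuE => nuE.
  + by rewrite (eqN 11%N).
  + by rewrite (eqN 23%N).
  by rewrite (eqN 59%N).
rewrite 4!big_cons.
have sum_ge0 : 0 <= \sum_(u <- s) (1 - u.1%:R^-1) / u.2%:R :> rat.
  rewrite big_seq sumr_ge0 // => u us; apply: le_trans (terms_ge u _); first lra.
  by rewrite !inE us !orbT.
have [tp tq] := (terms_ge p (mem_head _ _), terms_ge q).
have := terms_ge r; have := terms_ge t; rewrite !inE !eqxx !orbT => /(_ isT) ht /(_ isT) hr.
by move: tq; rewrite !inE eqxx orbT => /(_ isT) hq; lra.
Qed.

(** * Groups in which noncentral elements have abelian centralisers *)

Section ClassEquation.

Local Open Scope group_scope.

Variables (gT : finGroupType) (L : {group gT}).
Hypothesis abelian_cent1 : forall x, x \in L :\: 'Z(L) -> abelian 'C_L[x].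
Hypothesis conj_cent1 : forall x y, x \in L :\: 'Z(L) -> y \in L ->
  x ^ y \in 'C_L[x] -> (x ^ y == x) || (x ^ y == x^-1)%g.

Lemma center_sub_cent1 x : x \in L -> 'Z(L) \subset 'C_L[x].
Proof.
move=> Lx; rewrite subsetI center_sub /=; apply/subsetP=> z /centerP[_ cz].
by apply/cent1P; apply: cz.
Qed.

(** Commutation is transitive on noncentral elements, which is what makes
    distinct centralisers meet in the centre. *)
Lemma cent1_noncentral_eq x y : x \in L :\: 'Z(L) -> y \in 'C_L[x] :\: 'Z(L) ->
  'C_L[y] = 'C_L[x].
Proof.
have sub u v : u \in L :\: 'Z(L) -> v \in L -> v \in 'C_L[u] -> 'C_L[u] \subset 'C_L[v].
  move=> /abelian_cent1/centsP cAA Lv Cv; rewrite subsetI subsetIl.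
  by apply/subsetP => w Cw; apply/cent1P; apply: (cAA w Cw v Cv).
move=> Lx; have /setDP[Lx1 _] := Lx => /setDP[Cy nZy].
have /setIP[Ly cxy] := Cy.
apply/eqP; rewrite eqEsubset !sub //; first by rewrite inE nZy.
by rewrite inE Lx1 /= cent1C.
Qed.

Lemma card_same_cent1 x : x \in L :\: 'Z(L) ->
  #|[set y in L :\: 'Z(L) | 'C_L[y] == 'C_L[x]]| = (#|'C_L[x]| - #|'Z(L)|)%N.
Proof.
move=> Lx; have /setDP[Lx1 _] := Lx.
have <- := cardsDS (center_sub_cent1 Lx1).
apply: eq_card => y; apply/idP/idP => [|Cy].
  rewrite inE => /andP[/setDP[Ly nZy] /eqP <-].
  by rewrite inE nZy inE Ly cent1id.
rewrite inE (cent1_noncentral_eq Lx Cy) eqxx andbT.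
by case/setDP: Cy => /setIP[Ly _] nZy; rewrite inE nZy.
Qed.

(** The elements counted are partitioned by their centralisers, which run over
    the conjugates of the centraliser of x. *)
Lemma card_conjugate_cent1 x : x \in L :\: 'Z(L) ->
  #|[set y in L :\: 'Z(L) | 'C_L[y] :^: L == 'C_L[x] :^: L]| =
  (#|L : 'N_L('C_L[x])| * (#|'C_L[x]| - #|'Z(L)|))%N.
Proof.
move=> Lx; have /setDP[Lx1 _] := Lx.
rewrite -card_conjugates -sum1_card.
rewrite (partition_big (fun y => 'C_L[y]) (mem ('C_L[x] :^: L))) /= => [|y]; last first.
  by rewrite inE => /andP[_ /eqP <-]; apply: orbit_refl.
rewrite -sum_nat_const; apply: eq_bigr => _ /imsetP[g Lg ->].
have CxgE : 'C_L[x] :^ g = 'C_L[x ^ g] by rewrite conjIg conjGid // cent1J.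
have Lxg : x ^ g \in L :\: 'Z(L).
  have [_ nZL] := andP (center_normal L); case/setDP: Lx => _ nZx.
  by rewrite in_setD memJ_norm ?(subsetP nZL) // nZx groupJ.
rewrite -(cardJg _ g) CxgE -card_same_cent1 // -sum1_card.
apply: eq_bigl => y; rewrite !in_set -andbA; congr (_ && _).
have [->|_] := eqVneq 'C_L[y] 'C_L[x ^ g]; last by rewrite andbF.
by rewrite -CxgE andbT; apply/eqP; apply: (orbit_act 'Js).
Qed.

(** The index counts the conjugates of x under the normaliser; they commute with
    x, so they are x or its inverse. *)
Lemma index_normaliser_cent1 x : x \in L :\: 'Z(L) ->
  (#|'N_L('C_L[x]) : 'C_L[x]| <= 2)%N.
Proof.
move=> Lx; have /setDP[Lx1 _] := Lx.
have CNE : 'C_('N_L('C_L[x]))[x] = 'C_L[x].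
  rewrite setIAC (setIidPl _) //; exact: normG.
rewrite -{2}CNE index_cent1.
apply: leq_trans (_ : #|[set x; x^-1]| <= 2)%N; last by rewrite cards2; case: (_ != _).
apply/subset_leq_card/subsetP => _ /imsetP[y /setIP[Ly Ny] ->].
rewrite !inE; apply: conj_cent1 => //.
by rewrite memJ_norm // inE Lx1 cent1id.
Qed.

(** Each conjugacy class of centralisers C contributes the pair
    (|C : Z|, |N_L(C) : C|). *)
Lemma class_equation_cent1 : exists s : seq (nat * nat),
  (\sum_(p <- s) (1 - p.1%:R^-1) / p.2%:R = 1 - #|L : 'Z(L)|%:R^-1 :> rat)%R /\
  forall p, p \in s -> [/\ (2 <= p.1)%N, (p.2 == 1%N) || (p.2 == 2%N) &
    exists2 A : {group gT}, A \subset L /\ abelian A & (#|L : A| * p.1 = #|L : 'Z(L)|)%N].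
Proof.
pose D := L :\: 'Z(L); pose k y := 'C_L[y] :^: L.
pose rep K := odflt 1 [pick x in D | k x == K].
have repP K : K \in k @: D -> rep K \in D /\ k (rep K) = K.
  case/imsetP => x Dx ->; rewrite /rep; case: pickP => [y /andP[Dy /eqP]|/(_ x)] //.
  by rewrite Dx eqxx.
have sZC x : x \in D -> 'Z(L) \subset 'C_L[x].
  by case/setDP => Lx _; apply: center_sub_cent1.
have sCN x : 'C_L[x] \subset 'N_L('C_L[x]) by rewrite subsetI subsetIl normG.
exists [seq (#|'C_L[rep K] : 'Z(L)|, #|'N_L('C_L[rep K]) : 'C_L[rep K]|)
          | K <- enum (k @: D)].
split=> [|_ /mapP[K + ->]]; last first.
  rewrite mem_enum => /repP[]; move: (rep K) => x Dx _ /=; split.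
  - rewrite indexg_gt1; case/setDP: Dx => Lx nZx; apply: contra nZx => /subsetP; apply.
    by rewrite inE Lx cent1id.
  - have := index_normaliser_cent1 Dx; have := indexg_gt0 'N_L('C_L[x]) 'C_L[x].
    by case: #|_ : _| => [|[|[|]]].
  exists 'C_L[x]%G => /=; first by rewrite subsetIl abelian_cent1.
  by rewrite Lagrange_index ?subsetIl ?sZC.
rewrite big_map big_enum /=.
have L0 : (#|L|%:R != 0 :> rat)%R by rewrite pnatr_eq0 -lt0n cardG_gt0.
transitivity (\sum_(K in k @: D) #|[set y in D | k y == K]|%:R / #|L|%:R : rat)%R.
  apply: eq_bigr => K /repP[]; move: (rep K) => x Dx <-.
  have CE := Lagrange (sZC x Dx).
  have LE := Lagrange (subsetIl L 'N('C_L[x])).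
  rewrite -(Lagrange (sCN x)) -CE in LE.
  rewrite card_conjugate_cent1 // -{1}LE -{1}CE.
  have := indexg_gt0 'C_L[x] 'Z(L); have := indexg_gt0 'N_L('C_L[x]) 'C_L[x].
  have := indexg_gt0 L 'N_L('C_L[x]); have := cardG_gt0 'Z(L).
  rewrite -!(ltr0n rat) !natrM => /lt0r_neq0 z0 /lt0r_neq0 m0 /lt0r_neq0 c0 /lt0r_neq0 a0.
  rewrite natrB ?leq_pmulr ?indexg_gt0 // natrM.
  by field; rewrite a0 c0 m0 z0.
rewrite -mulr_suml -natr_sum.
have -> : (\sum_(K in k @: D) #|[set y in D | k y == K]| = #|L| - #|'Z(L)|)%N.
  rewrite -cardsDS ?center_sub // -sum1_card (partition_big k (mem (k @: D))) /=.
    by apply: eq_bigr => K _; rewrite -sum1_card; apply: eq_bigl => y; rewrite inE.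
  by move=> y Dy; apply: imset_f.
rewrite -(Lagrange (center_sub L)) natrB ?leq_pmulr ?indexg_gt0 // natrM.
have := indexg_gt0 L 'Z(L); have := cardG_gt0 'Z(L).
rewrite -!(ltr0n rat) => /lt0r_neq0 z0 /lt0r_neq0 a0.
by field; rewrite a0 z0.
Qed.

(** The square of a degree is at most N = |L : Z(L)| and a degree divides N, which
    settles N = 12, 24 and 60. Unless L is abelian, there is otherwise an abelian
    subgroup of index at most 2. *)
Lemma irr1_le6_of_abelian_cent1 (i : Iirr L) : ('chi_i 1%g <= 6%:R)%R.
Proof.
have [s [s_sum s_ok]] := class_equation_cent1.
have degE := irr1_degree i; set n := irr_degree _ in degE.
have sZZ : 'Z(L) \subset ('Z('chi_i)%R)%CF by rewrite -cap_cfcenter_irr (bigcap_inf i).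
have n_sqr : (n ^ 2 <= #|L : 'Z(L)|)%N.
  apply: leq_trans (dvdn_leq (indexg_gt0 _ _) (indexgS L sZZ)).
  by rewrite -(ler_nat algC) natrX -degE irr1_bound.
have n_dvd : (n %| #|L : 'Z(L)|)%N.
  apply: dvdn_trans (indexgS L sZZ).
  by have := dvd_irr1_index_center i; rewrite degE dvdC_nat.
rewrite degE ler_nat.
have [p ps|N1|[p ps Np]|N60] := class_equation_solutions (indexg_gt0 _ _) _ s_sum.
- by have [] := s_ok p ps.
- by move: n_sqr; rewrite N1; case: (n) => [|[|]].
- have [p2 _ [A [sAL abA] iA]] := s_ok p ps.
  have := irr1_le_index_abelian i sAL abA; rewrite degE ler_nat => /leq_trans; apply.
  apply: leq_trans (_ : 2 <= _)%N => //.
  by rewrite -(leq_pmul2r (ltnW p2)) iA.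
have {N60} N60 : (#|L : 'Z(L)| \in [:: 12; 24; 60])%N by [].
(* 8 ^ 2 exceeds 60, and 7 divides none of 12, 24, 60. *)
have n_lt8 : (n < 8)%N.
  rewrite -ltn_sqr; apply: leq_ltn_trans n_sqr _.
  by move: N60; rewrite !inE => /or3P[] /eqP->.
move: n_lt8 n_dvd; rewrite ltnS leq_eqVlt => /orP[/eqP-> |//].
by move: N60; rewrite !inE => /or3P[] /eqP->.
Qed.

End ClassEquation.

(** * Quaternions *)

Record quat (R : Type) := Quat { qre : R; qi : R; qj : R; qk : R }.

Definition tuple_of_quat R (x : quat R) := (qre x, qi x, qj x, qk x).
Definition quat_of_tuple R (x : R * R * R * R) := Quat x.1.1.1 x.1.1.2 x.1.2 x.2.
Lemma tuple_of_quatK R : cancel (@tuple_of_quat R) (@quat_of_tuple R).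
Proof. by case. Qed.

HB.instance Definition _ (R : choiceType) :=
  Choice.copy (quat R) (can_type (@tuple_of_quatK R)).

Section QuatRing.
Variable R : comNzRingType.
Implicit Types x y z : quat R.

Definition qadd x y := Quat (qre x + qre y) (qi x + qi y) (qj x + qj y) (qk x + qk y).
Definition qopp x := Quat (- qre x) (- qi x) (- qj x) (- qk x).
Definition qmul x y := let: Quat a b c d := x in let: Quat a' b' c' d' := y in
  Quat (a * a' - b * b' - c * c' - d * d') (a * b' + b * a' + c * d' - d * c')
       (a * c' - b * d' + c * a' + d * b') (a * d' + b * c' - c * b' + d * a').

Fact qaddA : associative qadd.
Proof. by move=> [? ? ? ?] [? ? ? ?] [? ? ? ?]; congr Quat; apply: addrA. Qed.
Fact qaddC : commutative qadd.
Proof. by move=> [? ? ? ?] [? ? ? ?]; congr Quat; apply: addrC. Qed.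
Fact qadd0 : left_id (Quat 0 0 0 0) qadd.
Proof. by move=> [? ? ? ?]; congr Quat; apply: add0r. Qed.
Fact qaddN : left_inverse (Quat 0 0 0 0) qopp qadd.
Proof. by move=> [? ? ? ?]; congr Quat; apply: addNr. Qed.

HB.instance Definition _ := GRing.isZmodule.Build (quat R) qaddA qaddC qadd0 qaddN.

Fact qmulA : associative qmul.
Proof. by move=> [? ? ? ?] [? ? ? ?] [? ? ? ?]; congr Quat => /=; ring. Qed.
Fact qmul1 : left_id (Quat 1 0 0 0) qmul.
Proof. by move=> [? ? ? ?]; congr Quat => /=; ring. Qed.
Fact qmulr1 : right_id (Quat 1 0 0 0) qmul.
Proof. by move=> [? ? ? ?]; congr Quat => /=; ring. Qed.
Fact qmulDl : left_distributive qmul qadd.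
Proof. by move=> [? ? ? ?] [? ? ? ?] [? ? ? ?]; congr Quat => /=; ring. Qed.
Fact qmulDr : right_distributive qmul qadd.
Proof. by move=> [? ? ? ?] [? ? ? ?] [? ? ? ?]; congr Quat => /=; ring. Qed.

HB.instance Definition _ :=
  GRing.Zmodule_isPzRing.Build (quat R) qmulA qmul1 qmulr1 qmulDl qmulDr.

Definition qconj x := Quat (qre x) (- qi x) (- qj x) (- qk x).
Definition qnorm x := qre x ^+ 2 + qi x ^+ 2 + qj x ^+ 2 + qk x ^+ 2.

Lemma qconjM x y : qconj (x * y) = qconj y * qconj x.
Proof. by case: x y => [? ? ? ?] [? ? ? ?]; congr Quat => /=; ring. Qed.

Lemma qreC x y : qre (x * y) = qre (y * x).
Proof. by case: x y => [? ? ? ?] [? ? ? ?] /=; ring. Qed.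

Lemma qconjK : involutive qconj.
Proof. by case=> *; rewrite /qconj /= !opprK. Qed.

Lemma qnormM x y : qnorm (x * y) = qnorm x * qnorm y.
Proof. by case: x y => [? ? ? ?] [? ? ? ?]; rewrite /qnorm /=; ring. Qed.

Lemma qnorm_conj x : qnorm (qconj x) = qnorm x.
Proof. by rewrite /qnorm /= !sqrrN. Qed.

Lemma qmul_conj x : x * qconj x = Quat (qnorm x) 0 0 0.
Proof. by case: x => [? ? ? ?]; congr Quat; rewrite /qnorm /=; ring. Qed.

End QuatRing.

Record uquat (R : comNzRingType) := UQuat { uval :> quat R; uvalP : qnorm uval == 1 }.
HB.instance Definition _ (R : comNzRingType) := [isSub for @uval R].
HB.instance Definition _ (R : comNzRingType) := [Choice of uquat R by <:].

Section UnitQuat.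
Variable R : comNzRingType.
Implicit Types x y z : uquat R.

Lemma uqmul_subproof x y : qnorm (uval x * uval y) == 1.
Proof. by rewrite qnormM (eqP (uvalP x)) (eqP (uvalP y)) mulr1. Qed.
Lemma uqone_subproof : qnorm (1 : quat R) == 1.
Proof. by rewrite /qnorm /= !expr0n expr1n !addr0. Qed.
Lemma uqinv_subproof x : qnorm (qconj x) == 1.
Proof. by rewrite qnorm_conj uvalP. Qed.

Definition uqmul x y := UQuat (uqmul_subproof x y).
Definition uqone := UQuat uqone_subproof.
Definition uqinv x := UQuat (uqinv_subproof x).

Lemma uqmulA : associative uqmul.
Proof. by move=> x y z; apply/val_inj/mulrA. Qed.
Lemma uqmul1 : left_id uqone uqmul.
Proof. by move=> x; apply/val_inj/mul1r. Qed.
Lemma uqmulr1 : right_id uqone uqmul.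
Proof. by move=> x; apply/val_inj/mulr1. Qed.
Lemma uqmulrV : right_inverse uqone uqinv uqmul.
Proof. by move=> x; apply/val_inj; rewrite /= qmul_conj (eqP (uvalP x)). Qed.
Lemma uqmulV : left_inverse uqone uqinv uqmul.
Proof.
move=> x; have := uqmulrV (uqinv x); congr (uqmul _ _ = _).
by apply/val_inj; rewrite /= qconjK.
Qed.

HB.instance Definition _ :=
  isGroup.Build (uquat R) uqmulA uqmul1 uqmulr1 uqmulV uqmulrV.
End UnitQuat.

Section Commutation.
Variable R : realFieldType.

(** Commuting means that the cross product of the vector parts vanishes. *)
Lemma commute_parallel (x y : quat R) :
    (qi x, qj x, qk x) != (0, 0, 0) -> x * y = y * x ->
  exists t, y = Quat (qre y) (t * qi x) (t * qj x) (t * qk x).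
Proof.
case: x y => [a b c d] [a' b' c' d'] /= nz [_ e1 e2 e3].
have h1 : c * d' = d * c' by lra.
have h2 : d * b' = b * d' by lra.
have h3 : b * c' = c * b' by lra.
move: nz; rewrite !xpair_eqE -andbA.
have [b0|b0 _] := eqVneq b 0; last first.
  exists (b' / b); congr Quat; first by field.
    by apply: (mulfI b0); rewrite h3; field.
  by apply: (mulfI b0); rewrite -h2; field.
have [c0|c0 _] := eqVneq c 0; last first.
  exists (c' / c); congr Quat; [|by field|].
    by apply: (mulfI c0); rewrite -h3; field.
  by apply: (mulfI c0); rewrite h1; field.
rewrite /= => d0; exists (d' / d); congr Quat; [| |by field].
  by apply: (mulfI d0); rewrite h2; field.
by apply: (mulfI d0); rewrite -h1; field.
Qed.

Implicit Types x y z w : uquat R.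

Local Open Scope group_scope.

(** Real quaternions are central. *)
Lemma noncentral_vec x w : x * w != w * x -> (qi x, qj x, qk x) != (0, 0, 0)%R.
Proof.
apply: contra_neq => x0; apply/val_inj; move: x0.
case: x w => [[a b c d] /= _] [[a' b' c' d'] /= _] [-> -> ->].
by congr Quat => /=; ring.
Qed.

Lemma uquat_commute_trans x y z w :
  x * w != w * x -> commute x y -> commute x z -> commute y z.
Proof.
move=> /noncentral_vec nz /(congr1 val) /= /(commute_parallel nz)[t yE].
move=> /(congr1 val) /= /(commute_parallel nz)[u zE].
by apply/val_inj; rewrite /= yE zE; congr Quat => /=; ring.
Qed.

Lemma qre_conj x y : qre (x ^ y) = qre x.
Proof.
have -> : qre (x ^ y) = qre (x * y * y^-1) by exact: qreC (uval y^-1) (uval (x * y)).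
by rewrite mulgK.
Qed.

(** Conjugation preserves the real part and the norm, so a conjugate with
    parallel vector part differs from x at most by the sign of that part. *)
Lemma uquat_conj_commute x y w :
  x * w != w * x -> commute x (x ^ y) -> x ^ y = x \/ x ^ y = x^-1.
Proof.
move=> /noncentral_vec nz /(congr1 val) cxy.
have [t] : exists t : R, (uval (x ^ y)%g =
    Quat (qre (x ^ y)%g) (t * qi x) (t * qj x) (t * qk x) :> quat R)%R.
  exact: commute_parallel nz cxy.
rewrite qre_conj; move: (x ^ y) => v vE.
have := uvalP v; rewrite vE -(eqP (uvalP x)) /qnorm /=.
have -> : (qre x ^+ 2 + (t * qi x) ^+ 2 + (t * qj x) ^+ 2 + (t * qk x) ^+ 2 ==
  qre x ^+ 2 + qi x ^+ 2 + qj x ^+ 2 + qk x ^+ 2)%R =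
  ((t - 1) * (t + 1) * (qi x ^+ 2 + qj x ^+ 2 + qk x ^+ 2) == 0)%R.
  by rewrite -subr_eq0; congr (_ == _); ring.
have vec_gt0 : (qi x ^+ 2 + qj x ^+ 2 + qk x ^+ 2 != 0)%R.
  apply: contraNneq nz => /eqP.
  rewrite !paddr_eq0 ?addr_ge0 ?sqr_ge0 // !sqrf_eq0 => /andP[/andP[]].
  by rewrite !xpair_eqE => -> -> ->.
rewrite mulf_eq0 (negPf vec_gt0) orbF mulf_eq0 subr_eq0 addr_eq0.
case/orP => /eqP tE; [left | right]; apply/val_inj; rewrite /= vE tE.
  by rewrite !mul1r; case: (uval x).
by rewrite !mulN1r.
Qed.

End Commutation.

(** * Rotations of 4-space as pairs of unit quaternions *)

(** The pairs (v, w) and (i, j) both generate an action of the quaternion group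
    of order 8, by left multiplication and right multiplication; y is, up to a
    scalar, the average of the translates of x, hence it intertwines them. *)
Lemma quaternionic_average (A : pzRingType) (i j v w x : A) :
    i * i = -1 -> j * j = -1 -> j * i = - (i * j) ->
    v * v = -1 -> w * w = -1 -> w * v = - (v * w) ->
  let y := x - v * x * i - w * x * j - v * w * x * i * j in v * y = y * i /\ w * y = y * j.
Proof.
move=> ii jj ji vv ww wv y.
have ri z : z * i * i = - z by rewrite -mulrA ii mulrN1.
have rj z : z * j * j = - z by rewrite -mulrA jj mulrN1.
have rji z : z * j * i = - (z * i * j) by rewrite -mulrA ji mulrN mulrA.
split.
  rewrite !mulrBr !mulrBl !mulrA vv !(ri, rji, mulN1r, mulNr, opprK).
  by rewrite [v * x + _]addrC addrAC.
rewrite !mulrBr !mulrBl !mulrA wv ww !mulNr -(mulrA v w w) ww.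
by rewrite !(ri, rj, rji, mulrN1, mulN1r, mulNr, opprK) mul1r -addrA [LHS]addrC addrA.
Qed.

Section Rotations.
Variable R : rcfType.
Implicit Types (p q x y : quat R).

Definition qcoef x (i : nat) := nth 0 [:: qre x; qi x; qj x; qk x] i.
Definition qbase (i : nat) : quat R :=
  Quat (i == 0)%:R (i == 1)%:R (i == 2)%:R (i == 3)%:R.

Definition rotmx p q : 'M[R]_4 := \matrix_(i, j) qcoef (p * qbase j * qconj q) i.

Lemma qcoef_rot p q x (i : 'I_4) :
  qcoef (p * x * qconj q) i = \sum_j rotmx p q i j * qcoef x j.
Proof.
rewrite !big_ord_recl big_ord0 !mxE /=.
case: p q x => [? ? ? ?] [? ? ? ?] [? ? ? ?].
by case: i => [[|[|[|[|i]]]] //= _]; rewrite /qcoef /=; ring.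
Qed.

Lemma rotmxM p q p' q' : rotmx (p * p') (q * q') = rotmx p q *m rotmx p' q'.
Proof.
apply/matrixP => i j; rewrite !mxE qconjM !mulrA.
rewrite -(mulrA p p') -(mulrA p) qcoef_rot; apply: eq_bigr => k _.
by congr (_ * _); rewrite mxE.
Qed.

Lemma rotmx1 : rotmx 1 1 = 1%:M.
Proof.
apply/matrixP => i j; rewrite !mxE /qbase -val_eqE.
by case: i j => [[|[|[|[|i]]]] //= _] [[|[|[|[|j]]]] //= _]; rewrite /qcoef /=; ring.
Qed.

Lemma rotmx_tr p q : (rotmx p q)^T = rotmx (qconj p) (qconj q).
Proof.
apply/matrixP => i j; rewrite !mxE /qbase.
case: p q => [? ? ? ?] [? ? ? ?].
by case: i j => [[|[|[|[|i]]]] //= _] [[|[|[|[|j]]]] //= _]; rewrite /qcoef /=; ring.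
Qed.

Definition qreal (r : R) : quat R := Quat r 0 0 0.

Lemma qrealC r x : qreal r * x = x * qreal r.
Proof. by case: x => [? ? ? ?]; congr Quat => /=; ring. Qed.

Lemma qrealM r s : qreal r * qreal s = qreal (r * s).
Proof. by congr Quat => /=; ring. Qed.

Lemma qconj_mul x : qconj x * x = qreal (qnorm x).
Proof. by rewrite -{2}[x]qconjK qmul_conj qnorm_conj. Qed.

Lemma qnorm_gt0 x : x != 0 -> 0 < qnorm x.
Proof.
move=> x0; rewrite lt_neqAle eq_sym /qnorm !addr_ge0 ?sqr_ge0 // andbT.
apply: contra x0; rewrite !paddr_eq0 ?addr_ge0 ?sqr_ge0 // !sqrf_eq0.
by case: x => a b c d /= /andP[/andP[/andP[/eqP-> /eqP->] /eqP->] /eqP->].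
Qed.

Lemma quat_normalize x : x != 0 ->
  exists (u : uquat R) (r : R), uval u = x * qreal r /\ r ^+ 2 * qnorm x = 1.
Proof.
move=> /qnorm_gt0 x0; pose r := (Num.sqrt (qnorm x))^-1.
have r2 : r ^+ 2 * qnorm x = 1.
  by rewrite exprVn sqr_sqrtr ?ltW // mulVf // gt_eqF.
have rx : qnorm (x * qreal r) == 1.
  by rewrite qnormM mulrC -r2 /qnorm /= expr0n /= !addr0.
by exists (UQuat rx), r.
Qed.

(** Since 1 + p = p (1 + conj p), the square of 1 + p is a real multiple of p.
    When p = -1 the root is i. *)
Lemma uquat_sqrt (p : uquat R) : exists s : uquat R, (s * s)%g = p.
Proof.
have [p1|p1] := eqVneq (1 + uval p) 0.
  have i1 : qnorm (Quat 0 1 0 0 : quat R) == 1.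
    by rewrite /qnorm /= !expr0n expr1n /= add0r !addr0.
  exists (UQuat i1); apply/val_inj; rewrite /= -[uval p](addKr 1) p1 addr0.
  by congr Quat => /=; ring.
have [u [r [uE r2]]] := quat_normalize p1.
exists u; apply/val_inj; rewrite /= uE.
have sqr1 : (1 + uval p) * (1 + uval p) = uval p * qreal (qnorm (1 + uval p)).
  have {1}-> : 1 + uval p = uval p * qconj (1 + uval p).
    have qconj1D : qconj (1 + uval p) = 1 + qconj p.
      by case: (uval p) => ? ? ? ?; congr Quat => /=; ring.
    by rewrite qconj1D mulrDr mulr1 qmul_conj (eqP (uvalP p)) addrC.
  by rewrite -mulrA qconj_mul.
rewrite -mulrA qrealC mulrA mulrA sqr1 -!mulrA !qrealM.
by rewrite mulrC r2 mulr1.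
Qed.

Lemma rotmx_orthogonal (p q : uquat R) : rotmx p q *m (rotmx p q)^T = 1%:M.
Proof.
by rewrite rotmx_tr -rotmxM !qmul_conj (eqP (uvalP p)) (eqP (uvalP q)) rotmx1.
Qed.

(** The matrix is the square of an orthogonal matrix, as p and q are squares. *)
Lemma det_rotmx (p q : uquat R) : \det (rotmx p q) = 1.
Proof.
have [[s <-] [t <-]] := (uquat_sqrt p, uquat_sqrt q).
by rewrite rotmxM det_mulmx -{2}det_tr -det_mulmx rotmx_orthogonal det1.
Qed.

Lemma qcoefP x y : (forall i : 'I_4, qcoef x i = qcoef y i) -> x = y.
Proof.
case: x y => [a b c d] [a' b' c' d'] eq_xy.
have := (eq_xy (@Ordinal 4 0 isT), eq_xy (@Ordinal 4 1 isT),
         eq_xy (@Ordinal 4 2 isT), eq_xy (@Ordinal 4 3 isT)).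
by rewrite /qcoef /= => -[[[-> ->] ->] ->].
Qed.

Lemma qdotE x y : qre (qconj x * y) = \sum_(i < 4) qcoef x i * qcoef y i.
Proof.
rewrite !big_ord_recl big_ord0 /qcoef /=.
by case: x y => [? ? ? ?] [? ? ? ?] /=; ring.
Qed.

(** The trace of the linear map sending x to this expression is 4, because a
    product of a left and a right multiplication has trace 4 times the product
    of the two real parts, and i, j, k have real part 0. *)
Lemma average_neq0 v w u : exists x,
  x - v * x * qbase 1 - w * x * qbase 2 - u * x * qbase 1 * qbase 2 != 0.
Proof.
pose y x := x - v * x * qbase 1 - w * x * qbase 2 - u * x * qbase 1 * qbase 2.
have tr4 : qre (y (qbase 0)) + qi (y (qbase 1)) + qj (y (qbase 2)) + qk (y (qbase 3)) = 4.
  by rewrite {}/y; case: v w u => [? ? ? ?] [? ? ? ?] [? ? ? ?] /=; ring.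
(* If y vanished on the basis, the trace would be 0. *)
have [y0|] := eqVneq (y (qbase 0)) 0; last by exists (qbase 0).
have [y1|] := eqVneq (y (qbase 1)) 0; last by exists (qbase 1).
have [y2|] := eqVneq (y (qbase 2)) 0; last by exists (qbase 2).
have [y3|] := eqVneq (y (qbase 3)) 0; last by exists (qbase 3).
by move/eqP: tr4; rewrite y0 y1 y2 y3 /= !addr0 eq_sym pnatr_eq0.
Qed.

Lemma qconj_pure x : qre x = 0 -> qconj x = - x.
Proof. by case: x => a b c d /= ->; congr Quat; rewrite oppr0. Qed.

(** After multiplication by the conjugate of c0 the frame becomes 1, v, w with
    v and w anticommuting square roots of -1, and a unit q with v q = q i and
    w q = q j is needed: a normalised average is one, and p is c0 q. *)
Lemma orthonormal_frame (c0 c1 c2 : quat R) :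
    qnorm c0 = 1 -> qnorm c1 = 1 -> qnorm c2 = 1 ->
    qre (qconj c0 * c1) = 0 -> qre (qconj c0 * c2) = 0 -> qre (qconj c1 * c2) = 0 ->
  exists p q : uquat R, [/\ uval p * qbase 0 * qconj q = c0,
    uval p * qbase 1 * qconj q = c1 & uval p * qbase 2 * qconj q = c2].
Proof.
move=> n0 n1 n2 o01 o02 o12; set v := _ * c1 in o01; set w := _ * c2 in o02.
have conj_v := qconj_pure o01; have conj_w := qconj_pure o02.
have sqr_pure x : qnorm x = 1 -> qconj x = - x -> x * x = -1.
  by move=> nx cx; rewrite -[LHS]opprK -mulNr -cx qconj_mul nx.
have vv : v * v = -1 by rewrite sqr_pure // qnormM qnorm_conj n0 n1 mulr1.
have ww : w * w = -1 by rewrite sqr_pure // qnormM qnorm_conj n0 n2 mulr1.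
have wv : w * v = - (v * w).
  have vwE : v * w = - (qconj c1 * c2).
    rewrite -[v]opprK -conj_v qconjM qconjK mulNr -!mulrA (mulrA c0).
    by rewrite qmul_conj n0 mul1r.
  rewrite -qconj_pure; last by rewrite vwE /= o12 oppr0.
  by rewrite qconjM conj_v conj_w mulrNN.
have ii : qbase 1 * qbase 1 = -1 by congr Quat => /=; ring.
have jj : qbase 2 * qbase 2 = -1 by congr Quat => /=; ring.
have ji : qbase 2 * qbase 1 = - (qbase 1 * qbase 2) by congr Quat => /=; ring.
have [x y0] := average_neq0 v w (v * w).
have [] := quaternionic_average x ii jj ji vv ww wv.
move: y0; set y := x - _ - _ - _ => y0 vy wy.
have [q [r [qE _]]] := quat_normalize y0.
have vq : v * uval q = uval q * qbase 1 by rewrite qE mulrA vy -!mulrA qrealC.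
have wq : w * uval q = uval q * qbase 2 by rewrite qE mulrA wy -!mulrA qrealC.
have qq : uval q * qconj q = 1 by rewrite qmul_conj (eqP (uvalP q)).
have n0' : qnorm c0 == 1 by rewrite n0.
have cc : c0 * qconj c0 = 1 by rewrite qmul_conj n0.
exists (UQuat n0' * q)%g, q; split => /=.
- by rewrite -!mulrA (_ : qbase 0 = 1) // mul1r qq mulr1.
- by rewrite -!mulrA (mulrA _ (qbase 1)) -vq -mulrA qq mulr1 mulrA cc mul1r.
by rewrite -!mulrA (mulrA _ (qbase 2)) -wq -mulrA qq mulr1 mulrA cc mul1r.
Qed.

End Rotations.

Section RotationGroup.
Variable R : realType.

Lemma is_SO_rotmx (p q : uquat R) : is_SO (rotmx p q).
Proof. by rewrite /is_SO rotmx_orthogonal det_rotmx !eqxx. Qed.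

Definition rotation (pq : uquat R * uquat R) : SO R 4 := MkSO (is_SO_rotmx pq.1 pq.2).

Lemma rotationM : {morph rotation : x y / (x * y)%g}.
Proof. by move=> x y; apply/val_inj; rewrite /= rotmxM. Qed.

(** Such a matrix is triangular, so its determinant is its last diagonal entry,
    which is thus 1; the rows having norm 1, the rest of the last column
    vanishes. *)
Lemma SO_eq1_all_but_last n (C : SO R n.+1) :
  (forall i (j : 'I_n.+1), j != ord_max -> C i j = (i == j)%:R) -> C = 1%g.
Proof.
move=> CE.
have Cmax : C ord_max ord_max = 1.
  have := SO_det C; rewrite -det_tr det_trig.
    rewrite (bigD1 ord_max) //= big1 ?mulr1 => [|i i_max]; first by rewrite mxE.
    by rewrite mxE CE // eqxx.
  apply/is_trig_mxP => i j ij; rewrite mxE CE.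
    by rewrite -val_eqE /= gtn_eqF.
  by rewrite -val_eqE /= ltn_eqF // (leq_trans ij) // -ltnS.
apply/val_inj/matrixP => i j /=; rewrite [RHS]mxE.
have [->|/CE//] := eqVneq j ord_max.
have [->//|i_max] := eqVneq i ord_max.
have /matrixP/(_ i i) := SO_orthogonal C.
rewrite [LHS]mxE [RHS]mxE eqxx (bigD1 ord_max) //= (bigD1 i) //=.
rewrite big1 => [|k /andP[k_max ki]]; last by rewrite CE // eq_sym (negPf ki) mul0r.
rewrite !mxE (CE i i) // eqxx mulr1 addr0 -[RHS]add0r => /addIr/eqP.
by rewrite mulf_eq0 orbb => /eqP.
Qed.

Lemma SO_eq_all_but_last n (A B : SO R n.+1) :
  (forall i (j : 'I_n.+1), j != ord_max -> A i j = B i j) -> A = B.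
Proof.
move=> eqAB; suff C1 : (A^-1 * B)%g = 1%g by rewrite -[LHS]mulg1 -C1 mulVKg.
apply: SO_eq1_all_but_last => i j j_max.
have ATA : (SOval A)^T *m SOval A = 1%:M by apply/mulmx1C/SO_orthogonal.
transitivity (((SOval A)^T *m SOval A) i j); last by rewrite ATA mxE.
by rewrite mxE [RHS]mxE; apply: eq_bigr => k _; rewrite eqAB.
Qed.

(** The first three columns of A determine it among rotations, so it is enough
    to send 1, i and j to these columns. *)
Lemma rotation_surj (A : SO R 4) : exists x, rotation x = A.
Proof.
pose c (j : 'I_4) := Quat (A (@Ordinal 4 0 isT) j) (A (@Ordinal 4 1 isT) j)
  (A (@Ordinal 4 2 isT) j) (A (@Ordinal 4 3 isT) j).
have cE i j : qcoef (c j) (i : 'I_4) = A i j.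
  by case: i => [[|[|[|[|i]]]] hi] //=; congr (SOval A _ _); apply/val_inj.
have ATA : (SOval A)^T *m SOval A = 1%:M by apply/mulmx1C/SO_orthogonal.
have dotE j k : qre (qconj (c j) * c k) = (j == k)%:R.
  rewrite qdotE; transitivity (((SOval A)^T *m SOval A) j k); last by rewrite ATA mxE.
  by rewrite mxE; apply: eq_bigr => i _; rewrite !cE mxE.
have normE j : qnorm (c j) = 1 by have := dotE j j; rewrite qconj_mul eqxx.
have [p [q [e0 e1 e2]]] := orthonormal_frame (normE (@Ordinal 4 0 isT))
  (normE (@Ordinal 4 1 isT)) (normE (@Ordinal 4 2 isT)) (dotE _ _) (dotE _ _) (dotE _ _).
exists (p, q); apply: SO_eq_all_but_last => i j.
rewrite [LHS]mxE -cE; case: j => [[|[|[|[|j]]]] hj] //= _.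
- by rewrite e0 !cE; congr (SOval A _ _); apply/val_inj.
- by rewrite e1 !cE; congr (SOval A _ _); apply/val_inj.
- by rewrite e2 !cE; congr (SOval A _ _); apply/val_inj.
Qed.

(** The image of 1 gives p = q, and then p commutes with i and j. *)
Lemma rotation_ker x : rotation x = 1%g ->
  uval x.2 = uval x.1 /\ (uval x.1 = 1 \/ uval x.1 = -1).
Proof.
case: x => p q /(congr1 val)/matrixP /= pq1.
have fixE (j : 'I_4) : uval p * qbase R j * qconj q = qbase R j.
  apply: qcoefP => i; have := pq1 i j; rewrite mxE => ->.
  have /matrixP/(_ i j) := rotmx1 R; rewrite !mxE => <-.
  by rewrite mul1r /qconj /= !oppr0 mulr1.
have qq : qconj q * uval q = 1 by rewrite qconj_mul (eqP (uvalP q)).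
have commE (j : 'I_4) : uval p * qbase R j = qbase R j * uval q.
  by rewrite -[in RHS](fixE j) -[RHS]mulrA qq mulr1.
have pq : uval q = uval p.
  by have := commE (@Ordinal 4 0 isT); rewrite (_ : qbase R _ = 1) // mulr1 mul1r.
split=> //; have := commE (@Ordinal 4 1 isT); have := commE (@Ordinal 4 2 isT); rewrite pq.
have := eqP (uvalP p); case: (uval p) => a b c d; rewrite /qnorm /=.
move=> n1 [_ _ _ e1] [_ _ e2 e3].
have b0 : b = 0 by lra.
have c0 : c = 0 by lra.
have d0 : d = 0 by lra.
move: n1; rewrite b0 c0 d0 !expr0n /= !addr0 => /eqP.
by rewrite sqrf_eq1 => /orP[] /eqP ->; [left | right; congr Quat; rewrite oppr0].
Qed.

End RotationGroup.

(** * Finite groups of rotations *)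

Local Open Scope group_scope.

(** The preimage is finite: it is contained in the set of products of chosen
    preimages of the elements of H with elements of K. *)
Lemma finSubgroup_preimage (gT hT : groupType) (f : gT -> hT) (K : {fset gT})
    (H : finSubgroup hT) :
    {morph f : x y / x * y} -> (forall y, exists x, f x == y) ->
    (forall x, f x = 1 -> x \in K) ->
  exists G : finSubgroup gT, forall x, (x \in fsg_set G) = (f x \in fsg_set H).
Proof.
move=> fM f_onto kerK.
have f1 : f 1 = 1 by apply: (mulgI (f 1)); rewrite -fM !mulg1.
have fV x : f x^-1 = (f x)^-1 by apply: (mulgI (f x)); rewrite -fM !mulgV.
pose lift y := xchoose (f_onto y).
have liftK y : f (lift y) = y by apply/eqP/(xchooseP (f_onto y)).
pose S := [fset x in [fset lift y * z | y in fsg_set H, z in K] | f x \in fsg_set H]%fset.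
have SE x : (x \in S) = (f x \in fsg_set H).
  rewrite !inE /=; apply: andb_idl => Hx.
  apply/imfset2P; exists (f x) => //; exists ((lift (f x))^-1 * x); last by rewrite mulKVg.
  by apply: kerK; rewrite fM fV liftK mulVg.
have [H1 HD] := fsg_closed H.
have Sgroup : group_closed (mem S).
  split; first by rewrite SE f1.
  by move=> x y; rewrite !SE fM fV => ? ?; apply: HD.
by exists (FinSubgroup Sgroup).
Qed.

Lemma irr1_le_of_epimorphism (aT rT : finGroupType) (f : aT -> rT) (b : nat) :
    {morph f : x y / x * y} -> (forall y, exists x, f x = y) ->
    (forall i : Iirr [set: aT], ('chi_i 1%g <= b%:R)%R) ->
  forall i : Iirr [set: rT], ('chi_i 1%g <= b%:R)%R.
Proof.
move=> fM f_onto degb.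
pose F := Morphism (in2W fM : {in [set: aT] &, {morph f : x y / x * y}}).
have im_F : (F @* [set: aT])%G = [set: rT]%G.
  apply/val_inj/setP => y; rewrite [RHS]inE; have [x <-] := f_onto y.
  by apply/morphimP; exists x; rewrite ?inE.
suff degF (K : {group rT}) : (F @* [set: aT])%G = K ->
    forall i : Iirr K, ('chi_i 1%g <= b%:R)%R by exact: degF im_F.
move=> <- i; have := mem_irr i; rewrite -(cfMorph_irr _ (subxx _)) => /irrP[j chi_j].
by rewrite -cfMorph1 chi_j.
Qed.

(** The morphism f embeds G / M in the unit quaternions, where the two
    conditions on centralisers hold. *)
Lemma uquat_quotient_irr1_le6 (R : realFieldType) (gT : finGroupType) (G M : {group gT})
  (f : gT -> uquat R) :
    {morph f : x y / x * y} -> M <| G -> (forall x, x \in G -> (x \in M) = (f x == 1)) ->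
  forall i : Iirr (G / M), ('chi_i 1%g <= 6%:R)%R.
Proof.
move=> fM nsMG kerf.
have f1 : f 1 = 1 by apply: (mulgI (f 1)); rewrite -fM !mulg1.
have fV x : f x^-1 = (f x)^-1 by apply: (mulgI (f x)); rewrite -fM !mulgV.
have [sMG nMG] := andP nsMG.
pose fq (xbar : coset_of M) := f (repr xbar).
have fqE x : x \in G -> fq (coset M x) = f x.
  move=> Gx; rewrite /fq; have := mem_repr_coset (coset M x).
  rewrite val_coset ?(subsetP nMG) // => /rcosetP[m Mm ->].
  by rewrite fM; have := kerf m (subsetP sMG m Mm); rewrite Mm => /esym/eqP ->; rewrite mul1g.
have fqM : {in G / M &, {morph fq : x y / x * y}}.
  move=> _ _ /morphimP[x Nx Gx ->] /morphimP[y Ny Gy ->].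
  by rewrite -morphM // !fqE ?groupM.
have fqI : {in G / M &, injective fq}.
  move=> _ _ /morphimP[x Nx Gx ->] /morphimP[y Ny Gy ->]; rewrite /= !fqE // => fxy.
  apply/rcoset_kercosetP => //; rewrite mem_rcoset kerf ?groupM ?groupV //.
  by rewrite fM fV fxy mulgV.
have commE x y : x \in G / M -> y \in G / M ->
    (x * y == y * x) = (fq x * fq y == fq y * fq x).
  by move=> Gx Gy; rewrite -!fqM // (inj_in_eq fqI) ?groupM.
have noncentral x : x \in (G / M) :\: 'Z(G / M) ->
    x \in G / M /\ exists2 w, w \in G / M & fq x * fq w != fq w * fq x.
  case/setDP => Gx; rewrite inE Gx /= -sub_cent1 => /subsetPn[w Gw cxw].
  split=> //; exists w => //; rewrite -commE //.
  by apply: contra cxw => /eqP cxw; apply/cent1P.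
apply: irr1_le6_of_abelian_cent1 =>
    [x /noncentral[Gx [w Gw xw]]|x y /noncentral[Gx [w Gw xw]] Gy].
  apply/centsP => y /setIP[Gy /cent1P cxy] z /setIP[Gz /cent1P cxz].
  apply/eqP; rewrite commE //; apply/eqP.
  by apply: uquat_commute_trans xw _ _; apply/eqP; rewrite -commE //; apply/eqP.
case/setIP => Gxy /cent1P cxy.
have fqJ : fq (x ^ y) = fq x ^ fq y.
  by apply: (mulgI (fq y)); rewrite -conjgC -!fqM // ?groupJ // -conjgC.
have fqV : fq x^-1 = (fq x)^-1.
  apply: (mulgI (fq x)); rewrite -fqM ?groupV // !mulgV.
  by rewrite -(morph1 (coset M)) fqE.
have cxJ : commute (fq x) (fq x ^ fq y).
  by rewrite /commute -fqJ; apply/eqP; rewrite -commE //; apply/eqP.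
case: (uquat_conj_commute xw cxJ).
- by rewrite -fqJ => /(fqI _ _ Gxy Gx) ->; rewrite eqxx.
by rewrite -fqJ -fqV => /fqI ->; rewrite ?groupV ?eqxx ?orbT.
Qed.

Lemma exists_kernel (gT : finGroupType) (hT : groupType) (f : gT -> hT) :
    {morph f : x y / x * y} ->
  exists2 M : {group gT}, M <| [set: gT] & forall x, (x \in M) = (f x == 1).
Proof.
move=> fM; have f1 : f 1 = 1 by apply: (mulgI (f 1)); rewrite -fM !mulg1.
have fV x : f x^-1 = (f x)^-1 by apply: (mulgI (f x)); rewrite -fM !mulgV.
have kerG : group_set [set x | f x == 1].
  apply/group_setP; split=> [|x y]; first by rewrite inE f1.
  by rewrite !inE fM => /eqP-> /eqP->; rewrite mulg1.
exists (Group kerG) => [|x]; last by rewrite inE.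
apply/normalP; split=> [|y _]; first exact: subsetT.
apply/setP => x; rewrite mem_conjg !inE.
have -> : f (x ^ y^-1) = f x ^ (f y)^-1 by rewrite !conjgE !fM !fV.
exact: conjg_eq1.
Qed.

Theorem theorem10 (R : realType) (G : finSubgroup (SO R 4)) (n : nat)
    (rho : mx_representation R[i] [set: G] n)
    (irr : mx_irreducible rho) :
  (n <= 36)%N.
Proof.
have [i n_le] := irreducible_degree_le_irr1 irr.
rewrite -(ler_nat algC); apply: le_trans n_le _; move: i.
have normN1 : qnorm (- 1 : quat R)%R == 1%R.
  by rewrite /qnorm /= !sqrrN !expr0n expr1n /= !addr0.
pose m1 := UQuat normN1.
pose K := [fset (1, 1); (m1, m1)]%fset : {fset (uquat R * uquat R)}.
have onto (A : SO R 4) : exists x, rotation x == A.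
  by have [x <-] := rotation_surj A; exists x.
have kerK (x : uquat R * uquat R) : rotation x = 1 -> x \in K.
  move=> x1; have [eq_qp pE] := rotation_ker x1.
  have -> : x = (x.1, x.1).
    by rewrite [LHS]surjective_pairing; congr (_, _); apply/val_inj.
  have [->|->] : x.1 = 1 \/ x.1 = m1 by case: pE => pE; [left | right]; apply/val_inj.
    by rewrite in_fset2 eqxx.
  by rewrite in_fset2 eqxx orbT.
have [H HE] := finSubgroup_preimage G (@rotationM R) onto kerK.
pose f (x : H) : G := FSetSub (etrans (esym (HE (val x))) (valP x)).
apply: (@irr1_le_of_epimorphism H _ f 36).
- by move=> x y; apply/val_inj; rewrite /= rotationM.
- move=> A; have [x xA] := rotation_surj (val A).
  have Hx : x \in fsg_set H by rewrite HE xA; apply: valP.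
  by exists (FSetSub Hx); apply/val_inj.
pose p1 (x : H) := (val x).1; pose p2 (x : H) := (val x).2.
have p1M : {morph p1 : x y / x * y} by [].
have p2M : {morph p2 : x y / x * y} by [].
have [M1 nM1 kerM1] := exists_kernel p1M.
have [M2 nM2 kerM2] := exists_kernel p2M.
apply: (@irr1_le_mul_of_quotients _ _ M1 M2 6 6) => //.
- apply/setP => x; rewrite !inE kerM1 kerM2; apply/andP/eqP => [[/eqP x1 /eqP x2]|-> //].
  by apply/val_inj; rewrite /= [LHS]surjective_pairing -/(p1 x) -/(p2 x) x1 x2.
- exact: uquat_quotient_irr1_le6 p1M nM1 (in1W kerM1).
exact: uquat_quotient_irr1_le6 p2M nM2 (in1W kerM2).
Qed.
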